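(* Let $(L,* )$ be an LD-system. An oracle that solves the generalized $m$-simItLDP for $S_B$ and the $n$-simItLDP is sufficient to break key establishment Protocol 1.
   Context: An LD-system is a set $L$ with a binary operation $*$ such that $x*(y*z)=(x*y)*(x*z)$ for all $x,y,z\in L$. $\langle y_1,\ldots,y_k\rangle_*$ denotes the submagma of $(L,* )$ generated by $y_1,\ldots,y_k$. For $x=(x_1,\ldots,x_k)\in L^k$ put $\phi_x(y)=x_k*(x_{k-1}*\cdots*(x_2*(x_1*y))\cdots)$. Protocol 1: public elements $s_1,\ldots,s_m,t_1,\ldots,t_n\in L$ are given, with $S_A=\langle s_1,\ldots,s_m\rangle_*$, $S_B=\langle t_1,\ldots,t_n\rangle_*$. Alice's secret key is $(a_0,a)\in S_A\times L^{k_A}$ and Bob's secret key is $b\in S_B^{k_B}$ (for some secret $k_A,k_B\ge 1$). Put $\alpha=\phi_a$, $\beta=\phi_b$. Alice publishes $t_i'=\alpha(t_i)$ ($1\le i\le n$) and $p_0=\alpha(a_0)$; Bob publishes $s_j'=\beta(s_j)$ ($1\le j\le m$). The shared key is $K=\alpha(\beta(a_0))$. Breaking the protocol means finding $K$ from the public data $s_j,s_j',t_i,t_i',p_0$ (the attacker can evaluate $*$). $n$-simItLDP ($n$-simultaneous iterated LD-problem): given pairs $(t_1,t_1'),\ldots,(t_n,t_n')\in L^2$ for which there are unknown $k$ and $a\in L^k$ with $t_i'=\phi_a(t_i)$ for all $i\le n$, find $k'\in\mathbb{N}$ and $a'\in L^{k'}$ with $\phi_{a'}(t_i)=t_i'$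 for all $i\le n$. Generalized $m$-simItLDP for $S_B$: given pairs $(s_1,s_1'),\ldots,(s_m,s_m')\in L^2$ for which there are unknown $k_B$ and $b$ with $s_i'=\phi_b(s_i)$ for all $i\le m$, find $k_B'\in\mathbb{N}$ and $b'\in S_B^{k_B'}$ with $\phi_{b'}(s_i)=s_i'$ for all $i\le m$. *)

(* Defs.v *)
From mathcomp Require Import all_boot.
Set Implicit Arguments.
Unset Strict Implicit.
Unset Printing Implicit Defensive.

Local Open Scope group_scope.

Definition LD_system (L : magmaType) : Prop :=
  forall x y z : L, x * (y * z) = (x * y) * (x * z).

(* The submagma generated by the family y. *)
Inductive submagma (L : magmaType) (k : nat) (y : 'I_k -> L) : L -> Prop :=
| submagma_gen i : submagma y (y i)
| submagma_mul u v : submagma y u -> submagma y v -> submagma y (u * v).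

(* phi [:: x_1; ..; x_k] y = x_k * (x_(k-1) * ... * (x_2 * (x_1 * y))) *)
Definition phi (L : magmaType) (x : seq L) (y : L) : L :=
  foldl (fun z xi => xi * z) y x.

(* An oracle receives the pairs (t_i, t'_i) and returns a tuple of elements of
   L; as its length k' is chosen by the oracle, the answer is a sequence, with
   k' its size.  Nothing is required of the answer to an input that is not an
   instance of the problem. *)
Definition oracle (L : magmaType) (n : nat) : Type := ('I_n -> L * L) -> seq L.

Definition solves_simItLDP (L : magmaType) (n : nat) (O : oracle L n) : Prop :=
  forall p : 'I_n -> L * L,
    (exists (k : nat) (a : k.-tuple L),
        0 < k /\ forall i, (p i).2 = phi a (p i).1) ->
    forall i, phi (O p) (p i).1 = (p i).2.

Definition solves_gen_simItLDP (L : magmaType) (S : L -> Prop) (m : nat)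
    (O : oracle L m) : Prop :=
  forall p : 'I_m -> L * L,
    (exists (k : nat) (b : k.-tuple L),
        [/\ 0 < k, forall j, S (tnth b j)
          & forall i, (p i).2 = phi b (p i).1]) ->
    (forall j : 'I_(size (O p)), S (tnth (in_tuple (O p)) j)) /\
    (forall i, phi (O p) (p i).1 = (p i).2).

(* Attacks are finite programs over registers holding elements of L and
   registers holding sequences of elements of L.  The syntax does not mention
   L: a program reaches elements of L only through the public data, the
   operation * and the two oracles, and it always terminates. *)
Inductive operand (m n : nat) : Type :=
| PubS of 'I_m    (* s_j *)
| PubS' of 'I_m   (* s'_j *)
| PubT of 'I_n    (* t_i *)
| PubT' of 'I_n   (* t'_i *)
| PubP0           (* p_0 *)
| Reg of nat.

Arguments PubS {m n}.
Arguments PubS' {m n}.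
Arguments PubT {m n}.
Arguments PubT' {m n}.
Arguments PubP0 {m n}.
Arguments Reg {m n}.

Inductive program (m n : nat) : Type :=
| Skip
| Then of program m n & program m n
| Set_ (r : nat) of operand m n                   (* r := x *)
| Mul (r : nat) of operand m n & operand m n      (* r := x * y *)
| Clear (l : nat)                                 (* l := [::] *)
| Push (l : nat) of operand m n                   (* l := rcons l x *)
| For (r l : nat) of program m n                  (* for r in l do c *)
| AskGenSim (l : nat) of 'I_m -> operand m n * operand m n
| AskSim (l : nat) of 'I_n -> operand m n * operand m n.

Record public_data (L : magmaType) (m n : nat) := PublicData {
  pub_s : 'I_m -> L;
  pub_s' : 'I_m -> L;
  pub_t : 'I_n -> L;
  pub_t' : 'I_n -> L;
  pub_p0 : L }.

Record store (L : magmaType) := Store {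
  elt_reg : nat -> L;
  seq_reg : nat -> seq L }.

Definition upd (T : Type) (f : nat -> T) (r : nat) (v : T) : nat -> T :=
  fun r' => if r' == r then v else f r'.

Definition set_elt (L : magmaType) (st : store L) (r : nat) (v : L) :=
  Store (upd (elt_reg st) r v) (seq_reg st).

Definition set_seq (L : magmaType) (st : store L) (l : nat) (v : seq L) :=
  Store (elt_reg st) (upd (seq_reg st) l v).

Definition read (L : magmaType) (m n : nat) (d : public_data L m n)
    (st : store L) (x : operand m n) : L :=
  match x with
  | PubS j => pub_s d j
  | PubS' j => pub_s' d j
  | PubT i => pub_t d i
  | PubT' i => pub_t' d i
  | PubP0 => pub_p0 d
  | Reg r => elt_reg st r
  end.

Fixpoint exec (L : magmaType) (m n : nat) (Ogen : oracle L m)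
    (Osim : oracle L n) (d : public_data L m n) (c : program m n)
    (st : store L) : store L :=
  match c with
  | Skip => st
  | Then c1 c2 => exec Ogen Osim d c2 (exec Ogen Osim d c1 st)
  | Set_ r x => set_elt st r (read d st x)
  | Mul r x y => set_elt st r (read d st x * read d st y)
  | Clear l => set_seq st l [::]
  | Push l x => set_seq st l (rcons (seq_reg st l) (read d st x))
  | For r l c' =>
      foldl (fun st' v => exec Ogen Osim d c' (set_elt st' r v))
            st (seq_reg st l)
  | AskGenSim l q =>
      set_seq st l (Ogen (fun i => (read d st (q i).1, read d st (q i).2)))
  | AskSim l q =>
      set_seq st l (Osim (fun i => (read d st (q i).1, read d st (q i).2)))
  end.

(* L may have no distinguished element, so element registers start at p_0.
   The output is the final content of register 0. *)
Definition run (L : magmaType) (m n : nat) (Ogen : oracle L m)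
    (Osim : oracle L n) (P : program m n) (d : public_data L m n) : L :=
  elt_reg
    (exec Ogen Osim d P (Store (fun _ => pub_p0 d) (fun _ => [::]))) 0.

Definition protocol1_public (L : magmaType) (m n : nat)
    (s : 'I_m -> L) (t : 'I_n -> L) (a0 : L) (a b : seq L)
    : public_data L m n :=
  PublicData s (fun j => phi b (s j)) t (fun i => phi a (t i)) (phi a a0).

Definition protocol1_key (L : magmaType) (a0 : L) (a b : seq L) : L :=
  phi a (phi b a0).

Definition breaks_protocol1 (L : magmaType) (m n : nat)
    (s : 'I_m -> L) (t : 'I_n -> L) (attack : public_data L m n -> L) : Prop :=
  forall (a0 : L) (kA : nat) (a : kA.-tuple L) (kB : nat) (b : kB.-tuple L),
    submagma s a0 -> 0 < kA ->
    0 < kB -> (forall j, submagma t (tnth b j)) ->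
    attack (protocol1_public s t a0 a b) = protocol1_key a0 a b.

(* Main.v *)
(* The map phi a is an endomorphism of the LD-system, hence determined on a
   submagma by its values on generators, and
     phi a (phi b y) = phi (map (phi a) b) (phi a y).
   Let b' answer the generalized problem for (s, s') and a' the simultaneous
   problem for (t, t').  Then phi b' = phi b on S_A and phi a' = phi a on S_B.
   Since b' lies in S_B, the key is
     phi a (phi b a0) = phi a (phi b' a0) = phi (map (phi a') b') p0,
   and the attacker can evaluate the right-hand side. *)
Require Import Defs.
From mathcomp Require Import all_boot.

Set Implicit Arguments.
Unset Strict Implicit.
Unset Printing Implicit Defensive.

Local Open Scope group_scope.

Section PhiMorphism.

Variables (L : magmaType) (HL : LD_system L).

Lemma phiM (a : seq L) : {morph phi a : x y / x * y}.
Proof. by elim: a => [|c a IHa] x y //=; rewrite /phi /= HL -IHa. Qed.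

Lemma phi_phi (a b : seq L) (y : L) :
  phi a (phi b y) = phi (map (phi a) b) (phi a y).
Proof.
elim: b y => [|c b IHb] y //.
by rewrite -[phi (c :: b) y]/(phi b (c * y)) IHb phiM.
Qed.

Lemma eq_phi_submagma (k : nat) (y : 'I_k -> L) (a a' : seq L) :
  (forall i, phi a (y i) = phi a' (y i)) ->
  forall u, submagma y u -> phi a u = phi a' u.
Proof.
by move=> eq_y u; elim=> [i|v w _ IHv _ IHw] //; rewrite !phiM IHv IHw.
Qed.

End PhiMorphism.

(* Registers: 0 is the accumulator; 1 runs over b' (sequence 0) and is turned
   into phi a' of its initial value; 2 runs over a' (sequence 1). *)
Definition apply_phi (m n : nat) : program m n := For 2 1 (Mul 1 (Reg 2) (Reg 1)).

Definition apply_mapped_phi (m n : nat) : program m n :=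
  For 1 0 (Then (apply_phi m n) (Mul 0 (Reg 1) (Reg 0))).

Definition attack (m n : nat) : program m n :=
  Then (AskGenSim 0 (fun j => (PubS j, PubS' j)))
    (Then (AskSim 1 (fun i => (PubT i, PubT' i))) (apply_mapped_phi m n)).

Section Execution.

Variables (L : magmaType) (m n : nat) (Ogen : oracle L m) (Osim : oracle L n).
Variable d : public_data L m n.

Lemma exec_apply_phi (st : store L) :
  let st' := exec Ogen Osim d (apply_phi m n) st in
  [/\ elt_reg st' 0 = elt_reg st 0,
      elt_reg st' 1 = phi (seq_reg st 1) (elt_reg st 1)
    & seq_reg st' = seq_reg st].
Proof.
rewrite /=; move: (seq_reg st 1) => a; elim: a st => [|x a IHa] st //=.
by have [-> -> ->] := IHa (set_elt (set_elt st 2 x) 1 (x * elt_reg st 1)).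
Qed.

Lemma exec_apply_mapped_phi (st : store L) :
  elt_reg (exec Ogen Osim d (apply_mapped_phi m n) st) 0
  = phi (map (phi (seq_reg st 1)) (seq_reg st 0)) (elt_reg st 0).
Proof.
(* Generalizing the inner loop to any program with the same specification keeps [/=] from unfolding
   it. *)
rewrite /apply_mapped_phi; move: (apply_phi m n) exec_apply_phi => c exec_c.
rewrite /=; move: (seq_reg st 0) => b; elim: b st => [|x b IHb] st //.
have [e0 e1 es] := exec_c (set_elt st 1 x).
by rewrite /= IHb /= e0 e1 es.
Qed.

Lemma run_attack :
  run Ogen Osim (attack m n) d =
  phi (map (phi (Osim (fun i => (pub_t d i, pub_t' d i))))
           (Ogen (fun j => (pub_s d j, pub_s' d j)))) (pub_p0 d).
(* All element registers start at [p_0], hence so does the accumulator; the oracle calls reduce by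
   computation. *)
Proof. exact: exec_apply_mapped_phi. Qed.

End Execution.

Theorem proposition3p5 (L : magmaType) (HL : LD_system L) (m n : nat) :
  exists P : program m n,
    forall (s : 'I_m -> L) (t : 'I_n -> L) (Ogen : oracle L m) (Osim : oracle L n),
      solves_gen_simItLDP (submagma t) Ogen ->
      solves_simItLDP Osim ->
      breaks_protocol1 s t (run Ogen Osim P).
Proof.
exists (attack m n) => s t Ogen Osim HOgen HOsim a0 kA a kB b a0_s kA_gt0 kB_gt0 b_t.
rewrite run_attack /protocol1_key /=.
have [|b'_t eq_b] := HOgen (fun j => (s j, phi b (s j))); first by exists kB, b.
have eq_a := HOsim (fun i => (t i, phi a (t i))).
set b' := Ogen _ in b'_t eq_b *; set a' := Osim _ in eq_a *.
rewrite -(eq_phi_submagma HL eq_b a0_s) (phi_phi HL a b').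
congr phi.
(* Indexing [b'] by position brings in [b'_t]: [phi a] and [phi a'] are only known to agree on the
   submagma generated by [t]. *)
rewrite -[b']/(tval (in_tuple b')) -(map_tnth_enum (in_tuple b')) -!map_comp.
apply: eq_map => j /=; apply: (eq_phi_submagma HL _ (b'_t j)) => i.
by apply: eq_a; exists kA, a.
Qed.
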